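(* Let $p$ be a positive integer and let $n$ be an integer with $3 \le n \le 11$ or $n = 13$. Then there exists an $n$-dimensional nonconvex rational polytope $\mathcal{B} \subset \mathbb{R}^n$ whose period sequence is $(1, \dotsc, 1, p, 1)$, i.e. $p_{n-1} = p$ and $p_i = 1$ for all $i \ne n-1$, $0\le i\le n$.
   Context: A convex rational polytope is the convex hull of finitely many points of $\mathbb{Q}^n$. A (not necessarily convex) rational polytope is a topological ball $\mathcal{B}\subset\mathbb{R}^n$ that is a union $\bigcup_{i\in I}\mathcal{P}_i$ of a finite family of convex rational polytopes, all with the same affine span, such that every nonempty intersection $\mathcal{P}_i\cap\mathcal{P}_j$, $i\neq j$, is a common facet of $\mathcal{P}_i$ and $\mathcal{P}_j$. For such $\mathcal{B}$ (of dimension $n$ in $\mathbb{R}^n$) there are periodic functions $c_{\mathcal{B},i}\colon\mathbb{Z}\to\mathbb{Q}$ with finite periods such that $|k\mathcal{B}\cap\mathbb{Z}^n| = \sum_{i=0}^n c_{\mathcal{B},i}(k)k^i$ for all integers $k \ge 1$. The period sequence of $\mathcal{B}$ is $(p_0,\dotsc,p_n)$, where $p_i$ is the minimum period of $c_{\mathcal{B},i}$. *)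

(* Defs.v *)
From HB Require Import structures.
From mathcomp Require Import all_boot all_order all_algebra finmap.
From mathcomp Require Import all_classical all_reals all_analysis.

Set Implicit Arguments.
Unset Strict Implicit.
Unset Printing Implicit Defensive.

Import Order.TTheory GRing.Theory Num.Theory.
Import numFieldNormedType.Exports.

Local Open Scope classical_set_scope.
Local Open Scope ring_scope.

Definition conv_hull (R : realType) (n m : nat) (v : 'I_m -> 'rV[R]_n) :
    set 'rV[R]_n :=
  [set x | exists a : 'I_m -> R,
     [/\ forall j, 0 <= a j, \sum_j a j = 1 & x = \sum_j a j *: v j]].

Definition convex_rational_polytope (R : realType) (n : nat)
    (P : set 'rV[R]_n) : Prop :=
  exists (m : nat) (v : 'I_m -> 'rV[rat]_n),
    P = conv_hull (fun j => map_mx ratr (v j)).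

Definition affine_span (R : realType) (n : nat) (A : set 'rV[R]_n) :
    set 'rV[R]_n :=
  [set x | exists (m : nat) (v : 'I_m -> 'rV[R]_n) (a : 'I_m -> R),
     [/\ forall j, A (v j), \sum_j a j = 1 & x = \sum_j a j *: v j]].

(* The affine span of A is a translate of the row space of a matrix of rank d;
   no d is the dimension of the empty set. *)
Definition affine_dim (R : realType) (n : nat) (A : set 'rV[R]_n) (d : nat) :
    Prop :=
  exists (x0 : 'rV[R]_n) (M : 'M[R]_n),
    \rank M = d /\ affine_span A = [set x | (x - x0 <= M)%MS].

Definition face (R : realType) (n : nat) (F P : set 'rV[R]_n) : Prop :=
  exists (u : 'cV[R]_n) (b : R),
    (forall x, P x -> (x *m u) 0 0 <= b) /\
    F = P `&` [set x | (x *m u) 0 0 = b].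

Definition facet (R : realType) (n : nat) (F P : set 'rV[R]_n) : Prop :=
  face F P /\ exists d : nat, affine_dim F d /\ affine_dim P d.+1.

Definition homeomorphic (T U : topologicalType) (A : set T) (B : set U) :
    Prop :=
  exists (f : T -> U) (g : U -> T),
    [/\ {within A, continuous f} /\ {within B, continuous g},
        set_fun A B f, set_fun B A g,
        (forall x, A x -> g (f x) = x) &
        (forall y, B y -> f (g y) = y)].

(* The norm of 'rV[R]_d in the library is the sup norm, hence the explicit
   Euclidean ball. *)
Definition euclidean_unit_ball (R : realType) (d : nat) : set 'rV[R]_d :=
  [set x | \sum_i x 0 i ^+ 2 <= 1].

Definition topological_ball (R : realType) (n : nat) (B : set 'rV[R]_n) :
    Prop :=
  exists d : nat, homeomorphic B (@euclidean_unit_ball R d).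

Definition rational_polytope (R : realType) (n : nat) (B : set 'rV[R]_n) :
    Prop :=
  topological_ball B /\
  exists (m : nat) (P : 'I_m -> set 'rV[R]_n),
    [/\ B = \bigcup_i P i,
        forall i, convex_rational_polytope (P i),
        forall i j, affine_span (P i) = affine_span (P j) &
        forall i j, i != j -> P i `&` P j !=set0 ->
          facet (P i `&` P j) (P i) /\ facet (P i `&` P j) (P j)].

Definition lattice_points (R : realType) (n : nat) (B : set 'rV[R]_n)
    (k : nat) : set 'rV[int]_n :=
  [set z | exists2 x, B x & map_mx intr z = k%:R *: x].

(* [fset_set] sends infinite sets to the empty set; the lattice points in a
   dilate of a rational polytope are finite in number. *)
Definition lattice_count (R : realType) (n : nat) (B : set 'rV[R]_n)
    (k : nat) : nat :=
  #|` fset_set (lattice_points B k)|.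

Definition ehrhart_coefficients (R : realType) (n : nat) (B : set 'rV[R]_n)
    (c : 'I_n.+1 -> int -> rat) : Prop :=
  (forall i, exists2 q : nat, (0 < q)%N & periodic (c i) q%:Z) /\
  (forall k : nat, (0 < k)%N ->
     (lattice_count B k)%:R = \sum_(i < n.+1) c i k%:Z * k%:R ^+ i).

Definition minimum_period (f : int -> rat) (q : nat) : Prop :=
  [/\ (0 < q)%N, periodic f q%:Z &
      forall q' : nat, (0 < q')%N -> periodic f q'%:Z -> (q <= q')%N].

(* Periodic coefficients are determined by the counts: on a residue class mod a
   common period they are the coefficients of a polynomial with infinitely many
   prescribed values. So at most one [c] qualifies. *)
Definition period_sequence (R : realType) (n : nat) (B : set 'rV[R]_n)
    (p : 'I_n.+1 -> nat) : Prop :=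
  exists c : 'I_n.+1 -> int -> rat,
    ehrhart_coefficients B c /\ forall i, minimum_period (c i) (p i).

(* Main.v *)
Require Import Defs.
From HB Require Import structures.
From mathcomp Require Import all_boot all_order all_algebra finmap.
From mathcomp Require Import all_classical all_reals all_analysis.
From mathcomp Require Import ring lra.

Set Implicit Arguments.
Unset Strict Implicit.
Unset Printing Implicit Defensive.

Import Order.TTheory GRing.Theory Num.Theory.
Import numFieldNormedType.Exports.

Local Open Scope classical_set_scope.
Local Open Scope ring_scope.

(** The ball is the box [0, 2]^n with the corner ]1, 2]^(n-1) * ]1/p, 2]
    removed. The removed corner is half-open, so its k-th dilate contains
    exactly k^(n-1) (2k - floor(k/p)) lattice points, and the count is
    (2k+1)^n - k^(n-1) (2k - floor(k/p)): the only periodic contribution is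
    -(k mod p)/p, to the coefficient of k^(n-1).

    Writing d_l for the inverse of the l-th coordinate of the reentrant vertex,
    the ball is the locus min_l d_l x_l <= 1 in the box. Splitting it according
    to the index i of the minimum gives n combinatorial cubes, any two of which
    meet in the common facet d_i x_i = d_j x_j. It is star-shaped about half the
    reentrant vertex, with a continuous gauge, hence radially homeomorphic to
    the Euclidean ball. *)

(** * Affine spans and affine dimension *)

Section AffineSpan.
Variables (R : realType) (n : nat).
Implicit Types (A : set 'rV[R]_n).

(** The origin, added as an extra point at index [ord0], absorbs the missing weight
    [1 - \sum_j a j]. *)
Lemma affine_span_linear_comb A m (v : 'I_m -> 'rV[R]_n) (a : 'I_m -> R) :
  A 0 -> (forall j, A (v j)) -> affine_span A (\sum_j a j *: v j).
Proof.
move=> A0 Av.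
exists m.+1, (fun j => oapp v 0 (unlift ord0 j)),
  (fun j => oapp a (1 - \sum_j a j) (unlift ord0 j)).
split => [j||].
- by case: unliftP => [k _|_] /=.
- rewrite big_ord_recl unlift_none /= addrC.
  by under eq_bigr do rewrite liftK /=; rewrite addrC subrK.
- rewrite big_ord_recl unlift_none /= scaler0 add0r.
  by apply: eq_bigr => j _; rewrite liftK.
Qed.

Lemma affine_span_orthogonal A (u : 'cV[R]_n) (b : R) :
  A `<=` [set x | (x *m u) 0 0 = b] ->
  affine_span A `<=` [set x | (x *m u) 0 0 = b].
Proof.
move=> Au _ [m [v [a [Av a1 ->]]]] /=.
rewrite mulmx_suml summxE.
under eq_bigr => j _ do rewrite -scalemxAl mxE (Au _ (Av j)).
by rewrite -mulr_suml a1 mul1r.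
Qed.

Lemma affine_dim_full A : affine_span A = setT -> affine_dim A n.
Proof.
move=> AT; exists 0, 1%:M; split; first exact: mxrank1.
by rewrite AT; apply/seteqP; split => x //= _; rewrite submx1.
Qed.

End AffineSpan.

(** * Product weights on the vertices of a cube *)

Section ProductWeights.
Variables (R : comNzRingType) (n : nat) (t : 'I_n -> R).
Implicit Types (e : {ffun 'I_n -> bool}) (i l : 'I_n) (f g : bool -> R).

Definition coord_weight l (b : bool) : R := if b then t l else 1 - t l.

(** For [t] in [0, 1], this is the law of independent Bernoulli variables, [e l] being true with
    probability [t l]. The sums below are expectations. *)
Definition product_weight e : R := \prod_l coord_weight l (e l).

(** Independence: expanding the product of the two-term sums yields one term per choice function
    [e]. *)
Lemma sum_product_weight_prod (F : 'I_n -> bool -> R) :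
  \sum_e product_weight e * \prod_l F l (e l) =
  \prod_l (t l * F l true + (1 - t l) * F l false).
Proof.
transitivity (\sum_(e : {ffun 'I_n -> bool})
  \prod_l (coord_weight l (e l) * F l (e l))).
  by apply: eq_bigr => e _; rewrite big_split.
rewrite -(bigA_distr_bigA (fun l b => coord_weight l b * F l b)).
by apply: eq_bigr => l _; rewrite big_bool.
Qed.

Lemma sum_product_weight : \sum_e product_weight e = 1.
Proof.
have := sum_product_weight_prod (fun _ _ => 1).
rewrite [in RHS]big1 => [<-|l _]; last by rewrite !mulr1 addrC subrK.
by apply: eq_bigr => e _; rewrite big1 ?mulr1.
Qed.

Lemma sum_product_weight2 i l f g : l != i ->
  \sum_e product_weight e * (f (e i) * g (e l)) =
  (t i * f true + (1 - t i) * f false) * (t l * g true + (1 - t l) * g false).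
Proof.
(* Away from i and l the factor is 1, so its mean is [t j + (1 - t j) = 1] and drops out of the
   product. *)
move=> li; pose F j b := if j == i then f b else if j == l then g b else 1.
have FE e : \prod_j F j (e j) = f (e i) * g (e l).
  rewrite (bigD1 i) //= (bigD1 l) //= /F eqxx (negbTE li) eqxx big1 ?mulr1 //.
  by move=> j /andP[/negbTE -> /negbTE ->].
under eq_bigr do rewrite -FE.
rewrite sum_product_weight_prod (bigD1 i) //= (bigD1 l) //= /F.
rewrite !eqxx (negbTE li) big1 ?mulr1 //.
by move=> j /andP[/negbTE -> /negbTE ->]; rewrite !mulr1 addrC subrK.
Qed.

Lemma sum_product_weight1 l f :
  \sum_e product_weight e * f (e l) = t l * f true + (1 - t l) * f false.
Proof.
pose F j b := if j == l then f b else 1.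
have FE e : \prod_j F j (e j) = f (e l).
  by rewrite (bigD1 l) //= /F eqxx big1 ?mulr1 // => j /negbTE ->.
under eq_bigr do rewrite -FE.
rewrite sum_product_weight_prod (bigD1 l) //= /F.
rewrite eqxx big1 ?mulr1 //.
by move=> j /negbTE ->; rewrite !mulr1 addrC subrK.
Qed.

End ProductWeights.

Lemma product_weight_ge0 (R : realType) n (t : 'I_n -> R) e :
  (forall l, 0 <= t l <= 1) -> 0 <= product_weight t e.
Proof.
move=> t01; apply: prodr_ge0 => l _; rewrite /coord_weight.
by case/andP: (t01 l) => t0 t1; case: (e l); rewrite ?subr_ge0.
Qed.

Lemma conv_hull_enum (R : realType) n (I : finType) (v : I -> 'rV[R]_n) :
  conv_hull (fun j : 'I_#|I| => v (enum_val j)) =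
  [set x | exists a : I -> R,
     [/\ forall i, 0 <= a i, \sum_i a i = 1 & x = \sum_i a i *: v i]].
Proof.
apply/seteqP; split => x /= [a [a0 a1 xE]].
  exists (a \o enum_rank); split => [i||] /=; first exact: a0.
  - rewrite -a1 (reindex _ (onW_bij _ (@enum_val_bij I))) /=.
    by apply: eq_bigr => j _; rewrite enum_valK.
  - rewrite xE [RHS](reindex _ (onW_bij _ (@enum_val_bij I))) /=.
    by apply: eq_bigr => j _; rewrite enum_valK.
exists (a \o enum_val); split => [i||] /=; first exact: a0.
- by rewrite -a1 [RHS](reindex _ (onW_bij _ (@enum_val_bij I))).
- by rewrite xE (reindex _ (onW_bij _ (@enum_val_bij I))).
Qed.

(** * Gauges and radial homeomorphisms *)

Section Gauge.
Variables (R : realType) (V : normedModType R).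

(** Axioms for the Minkowski functional of a bounded star-shaped body. Convexity of the body, that
    is subadditivity of [g], is not asked for; the lower bound by the norm makes [g] vanish only at
    0. *)
Definition gauge (g : V -> R) : Prop :=
  [/\ continuous g,
      forall t x, 0 <= t -> g (t *: x) = t * g x &
      exists2 m : R, 0 < m & forall x, m * `|x| <= g x].

(** For gauges, this preserves each ray from 0 and carries the level sets of [g] to those of [h]. At
    0 the scalar is 0/0, which is 0 by convention. *)
Definition radial_map (g h : V -> R) (x : V) : V := (g x / h x) *: x.

Lemma gauge0 g : gauge g -> g 0 = 0.
Proof. by case=> _ gZ _; rewrite -(scale0r 0) gZ // mul0r. Qed.

Lemma gauge_ge0 g x : gauge g -> 0 <= g x.
Proof.
by case=> _ _ [m m0 gm]; apply: le_trans (gm x); rewrite mulr_ge0 // ltW.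
Qed.

Lemma gauge_eq0 g x : gauge g -> (g x == 0) = (x == 0).
Proof.
move=> Gg; apply/eqP/eqP => [gx0|->]; last exact: gauge0.
have [_ _ [m m0 gm]] := Gg.
by have := gm x; rewrite gx0 pmulr_rle0 // normr_le0 => /eqP.
Qed.

Lemma radial_map_continuous g h :
  gauge g -> gauge h -> continuous (radial_map g h).
Proof.
move=> Gg Gh x; have [gc _ _] := Gg; have [hc _ [m m0 hm]] := Gh.
have [->|x0] := eqVneq x 0; last first.
  apply: cvgZ; last exact: cvg_id.
  apply: cvgM; first exact: gc.
  by apply: cvgV; [rewrite gauge_eq0 | exact: hc].
have r0 : radial_map g h 0 = 0 by rewrite /radial_map scaler0.
suff : radial_map g h y @[y --> 0] --> 0 by rewrite /continuous_at r0.
apply: norm_cvg0.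
(* At 0 the quotient [g / h] need not converge, but [m * |y| <= h y] bounds the image by [g y / m],
   which tends to 0. *)
have le0 : forall y, 0 <= `|radial_map g h y| <= g y / m.
  move=> y; rewrite normr_ge0 /= /radial_map normrZ normrM normfV.
  rewrite !ger0_norm ?gauge_ge0 //.
  have [->|y0] := eqVneq y 0; first by rewrite normr0 mulr0 gauge0 ?mul0r.
  rewrite -mulrA ler_wpM2l ?gauge_ge0 //.
  rewrite mulrC ler_pdivrMr; last by rewrite lt_def gauge_eq0 // y0 gauge_ge0.
  by rewrite mulrC ler_pdivlMr // mulrC.
apply: (@squeeze_cvgr _ _ _ _ (fun=> 0) (fun y => g y / m)).
- by near=> y; exact: le0.
- exact: cvg_cst.
- rewrite -[X in _ --> X](mul0r m^-1) -(gauge0 Gg).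
  by apply: cvgM; [exact: gc | exact: cvg_cst].
Unshelve. all: by end_near.
Qed.

Lemma gauge_radial_map g h x : gauge g -> gauge h -> h (radial_map g h x) = g x.
Proof.
move=> Gg Gh; have [_ hZ _] := Gh.
rewrite /radial_map hZ ?divr_ge0 ?gauge_ge0 //.
have [->|x0] := eqVneq x 0; first by rewrite !gauge0 ?mul0r.
by rewrite divfK ?gauge_eq0.
Qed.

Lemma radial_mapK g h : gauge g -> gauge h ->
  cancel (radial_map g h) (radial_map h g).
Proof.
move=> Gg Gh x; rewrite {1}/radial_map gauge_radial_map //.
have [_ gZ _] := Gg; rewrite /radial_map gZ ?divr_ge0 ?gauge_ge0 //.
have [->|x0] := eqVneq x 0; first by rewrite !scaler0.
rewrite scalerA; have := gauge_eq0 x Gg; have := gauge_eq0 x Gh.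
rewrite (negbTE x0) => /negbT h0 /negbT g0.
rewrite -[RHS]scale1r; congr (_ *: _); field.
by rewrite h0 g0.
Qed.

Lemma homeomorphic_gauges g h c : gauge g -> gauge h ->
  homeomorphic [set x | g (x - c) <= 1] [set y | h y <= 1].
Proof.
move=> Gg Gh.
exists (fun x => radial_map g h (x - c)), (fun y => radial_map h g y + c).
split.
- split; apply: continuous_subspaceT => x.
    apply: (@continuous_comp _ _ _ (fun x => x - c)).
      by apply: cvgD; [exact: cvg_id | exact: cvg_cst].
    exact: radial_map_continuous.
  by apply: cvgD; [exact: radial_map_continuous | exact: cvg_cst].
- by move=> x /=; rewrite gauge_radial_map.
- by move=> y /=; rewrite addrK gauge_radial_map.
- by move=> x _; rewrite radial_mapK // subrK.
- by move=> y _; rewrite addrK radial_mapK.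
Qed.

End Gauge.

(** * Continuity of finite maxima, minima and sums *)

Section BigContinuous.
Variables (R : realType) (T : topologicalType) (I : Type).
Implicit Types (r : seq I) (F : I -> T -> R) (f : T -> R).

Lemma continuous_bigmax r F f : continuous f -> (forall i, continuous (F i)) ->
  continuous (fun x => \big[Num.max/f x]_(i <- r) F i x).
Proof.
move=> fc Fc; elim: r => [|i r IHr].
  by under eq_fun do rewrite big_nil.
under eq_fun do rewrite big_cons.
by move=> x; apply: (@continuous_max R T); [exact: Fc | exact: IHr].
Qed.

Lemma continuous_bigmin r F f : continuous f -> (forall i, continuous (F i)) ->
  continuous (fun x => \big[Num.min/f x]_(i <- r) F i x).
Proof.
move=> fc Fc; elim: r => [|i r IHr].
  by under eq_fun do rewrite big_nil.
under eq_fun do rewrite big_cons.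
by move=> x; apply: (@continuous_min R T); [exact: Fc | exact: IHr].
Qed.

Lemma continuous_big_add r F : (forall i, continuous (F i)) ->
  continuous (fun x => \sum_(i <- r) F i x).
Proof.
move=> Fc; elim: r => [|i r IHr].
  by under eq_fun do rewrite big_nil; move=> x; exact: cvg_cst.
under eq_fun do rewrite big_cons.
by move=> x; apply: cvgD; [exact: Fc | exact: IHr].
Qed.

End BigContinuous.

(** * The Euclidean norm as a gauge *)

Section EuclideanNorm.
Variables (R : realType) (n : nat).

Definition euclidean_norm (x : 'rV[R]_n) : R := Num.sqrt (\sum_i x 0 i ^+ 2).

Lemma normrV_le (x : 'rV[R]_n) (e : R) :
  0 <= e -> (forall i, `|x 0 i| <= e) -> `|x| <= e.
Proof.
move=> e0 xe; rewrite [leLHS]mx_normrE; apply/bigmax_leP; split => //.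
by move=> [i j] _ /=; rewrite ord1.
Qed.

Lemma gauge_euclidean_norm : gauge euclidean_norm.
Proof.
split.
- move=> x; apply: (@continuous_comp _ _ _ _ Num.sqrt);
    last exact: sqrt_continuous.
  apply: (@continuous_big_add R 'rV[R]_n) => i y.
  apply: (@continuous_comp _ _ _ (fun z : 'rV[R]_n => z 0 i) (fun t => t ^+ 2)).
    exact: coord_continuous.
  exact: exprn_continuous.
- move=> t x t0; rewrite /euclidean_norm.
  under eq_bigr do rewrite mxE exprMn.
  by rewrite -mulr_sumr sqrtrM ?sqr_ge0 // sqrtr_sqr ger0_norm.
- exists 1 => // x; rewrite mul1r; apply: normrV_le; first exact: sqrtr_ge0.
  move=> i; rewrite -sqrtr_sqr ler_wsqrtr // (bigD1 i) //= lerDl.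
  by apply: sumr_ge0 => j _; rewrite sqr_ge0.
Qed.

Lemma euclidean_unit_ballE :
  @euclidean_unit_ball R n = [set x | euclidean_norm x <= 1].
Proof.
by apply/seteqP; split => x /=; rewrite /euclidean_norm -sqrtr1 ler_sqrt.
Qed.

End EuclideanNorm.

(** * The notched box and its pieces *)

Section NotchedBox.
Variables (R : realType) (n : nat) (d : 'I_n -> nat).
Hypothesis d_gt0 : forall l, (0 < d l)%N.
Implicit Types (i j l : 'I_n) (x y : 'rV[R]_n).

Local Notation D l := ((d l)%:R : R).

Let D_ge1 l : 1 <= D l.
Proof. by rewrite ler1n. Qed.

Let D_gt0 l : 0 < D l.
Proof. by rewrite ltr0n. Qed.

Let D_neq0 l : D l != 0.
Proof. by rewrite gt_eqF. Qed.

Let invD_ge0 l : 0 <= (D l)^-1.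
Proof. by rewrite invr_ge0 ltW. Qed.

Let invD_le1 l : (D l)^-1 <= 1.
Proof. by rewrite invf_le1. Qed.

Definition notched_box : set 'rV[R]_n :=
  [set x | (forall l, 0 <= x 0 l <= 2) /\ exists l, D l * x 0 l <= 1].

Definition notched_box_piece i : set 'rV[R]_n :=
  [set x | [/\ forall l, 0 <= x 0 l <= 2, D i * x 0 i <= 1 &
               forall l, D i * x 0 i <= D l * x 0 l]].

Lemma notched_box_bigcup : notched_box = \bigcup_i notched_box_piece i.
Proof.
apply/seteqP; split => [x [x02 [l0 xl0]]|x [i _ [x02 xi _]]]; last first.
  by split => //; exists i.
have [i _ imin] := Order.TotalTheory.arg_minP (fun l => D l * x 0 l)
  (isT : xpredT l0).
exists i => //; split => // [|l]; last exact: imin.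
by apply: le_trans xl0; exact: imin.
Qed.

(** * The gauge of the notched box, and the homeomorphism with a ball *)

Section NotchGauge.

Let s l := 2 * D l.
Let r l := (2 - (s l)^-1)^-1.

Let s_ge2 l : 2 <= s l.
Proof. by rewrite /s; have := D_ge1 l; lra. Qed.

Let s_gt0 l : 0 < s l.
Proof. by rewrite (lt_le_trans _ (s_ge2 l)). Qed.

Let rV_gt0 l : 0 < 2 - (s l)^-1.
Proof.
suff : (s l)^-1 <= 2^-1 by lra.
by rewrite lef_pV2 // posrE.
Qed.

Let r_ge l : 2^-1 <= r l.
Proof.
rewrite /r lef_pV2 ?posrE // gerBl.
by rewrite invr_ge0 ltW.
Qed.

(** With y = x - [notch_center], whose coordinates are 1/s_l, the bounds by 1 on [- (s l * y 0 l)],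
    [r l * y 0 l] and [s l * y 0 l] say x_l >= 0, x_l <= 2 and d_l x_l <= 1. The first two must hold
    for all l (maximum), the third for some l (minimum). The default of the minimum is its own term
    at [i0], so it adds no new value. *)
Definition notch_gauge i0 y : R :=
  Num.max (\big[Num.max/0]_l Num.max (- (s l * y 0 l)) (r l * y 0 l))
          (\big[Num.min/s i0 * y 0 i0]_l (s l * y 0 l)).

Lemma gauge_notch_gauge i0 : gauge (notch_gauge i0).
Proof.
split.
- have Mc (c : R) l : continuous (fun y => c * y 0 l).
    by move=> y; exact: (cvgMl_tmp (a := c) (@coord_continuous R 1 n 0 l y)).
  move=> y; apply: (@continuous_max R 'rV[R]_n).
    apply: (@continuous_bigmax R 'rV[R]_n _ _ _ (fun=> 0)).
      exact: cst_continuous.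
    move=> l z; apply: (@continuous_max R 'rV[R]_n); 
      last exact: (Mc (r l) l z).
    exact: (cvgN (Mc (s l) l z)).
  apply: (@continuous_bigmin R 'rV[R]_n _ _ _ (fun y => s i0 * y 0 i0)).
    exact: (Mc (s i0) i0).
  by move=> l; exact: (Mc (s l) l).
- move=> t y t0; rewrite /notch_gauge maxr_pMr //; congr Num.max.
    rewrite (big_morph _ (fun a b => maxr_pMr a b t0) (mulr0 t)).
    apply: eq_bigr => l _; rewrite maxr_pMr // !mxE.
    by congr Num.max; ring.
  rewrite (big_morph _ (fun a b => minr_pMr a b t0) (erefl _)) !mxE mulrCA.
  by apply: eq_bigr => l _; rewrite mxE mulrCA.
(* The box part suffices: according to the sign of y_l, it grows with slope [r l] or [s l] in |y_l|,
   and both are at least 1/2. *)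
- exists 2^-1 => [|y]; first by rewrite invr_gt0.
  rewrite ler_pdivrMl // mulrC -ler_pdivrMr // le_max; apply/orP; left.
  rewrite ler_pdivrMr //; apply: normrV_le => [|l].
    by rewrite mulr_ge0 // bigmax_ge_id.
  rewrite -ler_pdivrMr //; apply: le_trans (le_bigmax _ _ l).
  rewrite le_max; apply/orP; have [yl|yl] := ger0P (y 0 l).
    by right; rewrite mulrC; exact: ler_wpM2r.
  left; rewrite -mulrN mulrC; apply: ler_wpM2r; first by rewrite oppr_ge0 ltW.
  by apply: le_trans (s_ge2 l); lra.
Qed.

Definition notch_center : 'rV[R]_n := \row_l (s l)^-1.

Lemma notched_boxE i0 :
  notched_box = [set x | notch_gauge i0 (x - notch_center) <= 1].
Proof.
have lowE l (x : R) : (- (s l * (x - (s l)^-1)) <= 1) = (0 <= x).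
  rewrite mulrBr divff ?gt_eqF // opprB gerBl.
  by rewrite pmulr_rge0.
have upE l (x : R) : (r l * (x - (s l)^-1) <= 1) = (x <= 2).
  by rewrite /r ler_pdivrMl // mulr1 lerD2r.
have notchE l (x : R) : (s l * (x - (s l)^-1) <= 1) = (D l * x <= 1).
  rewrite mulrBr divff ?gt_eqF // lerBlDr /s -mulrA.
  by apply/idP/idP; lra.
apply/seteqP; split => x /=; rewrite /notch_gauge ge_max.
  move=> [x02 [l xl]]; apply/andP; split.
    apply/bigmax_leP; split => // j _; rewrite ge_max !mxE lowE upE.
    exact: x02.
  by apply/bigmin_leP; right; exists l => //; rewrite !mxE notchE.
move=> /andP[/bigmax_leP[_ gbox] /bigmin_leP gnotch]; split.
  by move=> l; have := gbox l isT; rewrite ge_max !mxE lowE upE.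
case: gnotch => [|[l _]]; rewrite !mxE notchE; [by exists i0 | by exists l].
Qed.

Lemma topological_ball_notched_box i0 : topological_ball notched_box.
Proof.
exists n; rewrite (notched_boxE i0) euclidean_unit_ballE.
apply: homeomorphic_gauges; first exact: gauge_notch_gauge.
exact: gauge_euclidean_norm.
Qed.

End NotchGauge.

(** * The pieces as convex hulls of rational points *)

(** A vertex of a combinatorial cube: [e i] selects the side d_i x_i = 1 or x_i = 0, and for l other
    than i, [e l] selects x_l = 2 or d_l x_l = d_i x_i. *)
Definition piece_vertex i (e : {ffun 'I_n -> bool}) : 'rV[rat]_n :=
  \row_l if (l != i) && e l then 2 else if e i then (d l)%:R^-1 else 0.

Lemma ratr_piece_vertex i e l :
  map_mx ratr (piece_vertex i e) 0 l =
    if (l != i) && e l then 2 else if e i then (D l)^-1 else 0 :> R.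
Proof.
rewrite !mxE; case: (_ && _); first by rewrite ratr_nat.
by case: (e i); rewrite ?rmorph0 ?fmorphV ?rmorph_nat.
Qed.

Lemma notched_box_piece_vertex i e :
  notched_box_piece i (map_mx ratr (piece_vertex i e)).
Proof.
split=> [l||l]; rewrite !ratr_piece_vertex ?eqxx /=.
- have := invD_ge0 l; have := invD_le1 l.
  by case: ifP => _; last case: ifP => _; lra.
- by case: ifP => _; rewrite ?divff ?mulr0.
- have := D_ge1 l; case: (e i); rewrite ?mulr0 ?divff //; case: (_ && _);
    rewrite ?mulr0 ?divff //; lra.
Qed.

Lemma convex_rational_polytope_piece i :
  convex_rational_polytope (notched_box_piece i).
Proof.
exists #|{: {ffun 'I_n -> bool}}|, (fun k => piece_vertex i (enum_val k)).
rewrite (conv_hull_enum (fun e => map_mx ratr (piece_vertex i e))).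
apply/seteqP; split => x /=; last first.
  move=> [a [a0 a1 ->]].
  have le_lin (c : {ffun 'I_n -> bool} -> R) b : (forall e, c e <= b) ->
      \sum_e a e * c e <= b.
    move=> cb; rewrite -[leRHS]mul1r -a1 mulr_suml; apply: ler_sum => e _.
    exact: ler_wpM2l.
  have xE l : (\sum_e a e *: map_mx ratr (piece_vertex i e)) 0 l =
      \sum_e a e * (map_mx ratr (piece_vertex i e)) 0 l :> R.
    by rewrite summxE; apply: eq_bigr => e _; rewrite mxE.
  have v_piece := notched_box_piece_vertex i.
  split => [l||l]; rewrite !xE.
  - rewrite sumr_ge0 /= => [|e _]; last first.
      by rewrite mulr_ge0 //; case: (v_piece e) => /(_ l)/andP[].
    by apply: le_lin => e; case: (v_piece e) => /(_ l)/andP[].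
  - rewrite mulr_sumr; under eq_bigr do rewrite mulrCA.
    by apply: le_lin => e; case: (v_piece e).
  - rewrite !mulr_sumr; apply: ler_sum => e _.
    rewrite mulrCA [leRHS]mulrCA; apply: ler_wpM2l => //.
    by case: (v_piece e).
move=> [x02 xi xmin].
pose s := D i * x 0 i.
have s01 : 0 <= s <= 1.
  apply/andP; split => //; apply: mulr_ge0; first exact: ltW.
  by case/andP: (x02 i).
have den_gt0 l : 0 < 2 - s / D l.
  have : s / D l <= 1; last lra.
  rewrite ler_pdivrMr // mul1r; have := D_ge1 l; lra.
(* At fixed s = d_i x_i the piece is a box with sides [s/d_l, 2], l different from i; [t l] is the
   relative position of x_l in its side. The product weights with these parameters have barycenter
   x. *)
pose t l := if l == i then s else (x 0 l - s / D l) / (2 - s / D l).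
have t01 l : 0 <= t l <= 1.
  rewrite /t; case: ifP => // _; apply/andP; split.
    rewrite divr_ge0 ?(ltW (den_gt0 _)) // subr_ge0 ler_pdivrMr // mulrC.
    exact: xmin.
  by rewrite ler_pdivrMr // mul1r lerD2r; case/andP: (x02 l).
exists (product_weight t); split.
- by move=> e; exact: product_weight_ge0.
- exact: sum_product_weight.
apply/rowP => l; rewrite summxE.
under eq_bigr do rewrite mxE ratr_piece_vertex.
have [->|li] := eqVneq l i.
  rewrite /= (sum_product_weight1 t i (fun b => if b then (D i)^-1 else 0)).
  by rewrite mulr0 addr0 /t eqxx /s mulrAC divff // mul1r.
(* The vertex coordinate is 2 e_l + e_i (1 - e_l) / d_l, so its mean needs only one- and
   two-coordinate expectations. *)
transitivity (2 * (\sum_e product_weight t e * (e l)%:R) +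
   (D l)^-1 * (\sum_e product_weight t e * ((e i)%:R * (~~ e l)%:R))).
  rewrite (sum_product_weight1 t l (fun b => b%:R)).
  rewrite (sum_product_weight2 t (fun b => b%:R) (fun b => (~~ b)%:R) li) /=.
  rewrite /t eqxx (negbTE li); have := den_gt0 l; set q := s / D l => q2.
  have -> : s = q * D l by rewrite /q divfK.
  by field; rewrite D_neq0 gt_eqF.
rewrite !mulr_sumr -big_split /=; apply: eq_bigr => e _.
by case: (e l) => /=; case: (e i) => /=; ring.
Qed.

(** * Affine spans of the pieces and their common facets *)

(** Subtracting s = d_i x_i times the reentrant vertex from x leaves x_l - s/d_l along each axis,
    which vanishes when d_l x_l = s. Asking for axis points only at the other l covers both a whole
    piece and a facet d_i x_i = d_j x_j, which lacks the axis points at i and j. *)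
Lemma affine_span_coords (A : set 'rV[R]_n) i x :
  A 0 -> A (\row_l (D l)^-1) ->
  (forall l, D l * x 0 l != D i * x 0 i -> A (2 *: delta_mx 0 l)) ->
  affine_span A x.
Proof.
move=> A0 Aa Ae; pose s := D i * x 0 i.
pose v l : 'rV[R]_n := if l == i then \row_l (D l)^-1
  else if D l * x 0 l == s then 0 else 2 *: delta_mx 0 l.
pose a l := if l == i then s else (x 0 l - s / D l) / 2.
have -> : x = \sum_l a l *: v l; last first.
  apply: affine_span_linear_comb => // l; rewrite /v.
  by case: ifP => // _; case: ifPn => // ?; exact: Ae.
rewrite (bigD1 i) //= /a /v eqxx.
apply/rowP => j; rewrite !mxE summxE.
have termE l : l != i ->
    ((if l == i then s else (x 0 l - s / D l) / 2) *:
      (if l == i then \row_l (D l)^-1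
       else if D l * x 0 l == s then 0 else 2 *: delta_mx 0 l) : 'rV[R]_n) 0 j =
    (x 0 l - s / D l) * (j == l)%:R.
  move=> /negbTE ->; case: eqP => [<-|_]; rewrite !mxE ?mulr0.
    by rewrite mulrAC divff // mul1r subrr mul0r.
  by rewrite eqxx /=; field.
under eq_bigr => l li do rewrite termE //.
have [->|ji] := eqVneq j i.
  rewrite big1 => [|l]; first by rewrite addr0 /s mulrAC divff // mul1r.
  by rewrite eq_sym => /negbTE ->; rewrite mulr0.
rewrite (bigD1 j) //= eqxx mulr1 big1 ?addr0 => [|l /andP[_]].
  by rewrite addrC subrK.
by rewrite eq_sym => /negbTE ->; rewrite mulr0.
Qed.

Lemma notched_box_piece0 i : notched_box_piece i 0.
Proof.
split => [l||l]; rewrite !mxE ?mulr0 //; first by rewrite lexx ler0n.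
Qed.

Lemma notched_box_piece_tip i : notched_box_piece i (\row_l (D l)^-1).
Proof.
split => [l||l]; rewrite !mxE ?divff //.
by rewrite invD_ge0 (le_trans (invD_le1 l)) // ler1n.
Qed.

Lemma notched_box_piece_delta i l : l != i ->
  notched_box_piece i (2 *: delta_mx 0 l).
Proof.
move=> li; split => [j||j]; rewrite !mxE /=.
- by case: (_ == _); rewrite ?mulr1 ?mulr0 ?lexx ?ler0n.
- by rewrite eq_sym (negbTE li) !mulr0.
- rewrite [i == l]eq_sym (negbTE li) !mulr0.
  by apply: mulr_ge0; rewrite ?mulr_ge0 ?ler0n.
Qed.

Lemma affine_span_piece i : affine_span (notched_box_piece i) = setT.
Proof.
apply/seteqP; split => // x _; apply: (@affine_span_coords _ i).
- exact: notched_box_piece0.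
- exact: notched_box_piece_tip.
- move=> l xl; apply: notched_box_piece_delta.
  by apply: contra_neq xl => ->.
Qed.

Lemma affine_dim_notched_box i0 : affine_dim notched_box n.
Proof.
apply: affine_dim_full; apply/seteqP; split => // x _.
have : affine_span (notched_box_piece i0) x by rewrite affine_span_piece.
move=> [m [v [a [pv a1 ->]]]]; exists m, v, a; split => // j.
by rewrite notched_box_bigcup; exists i0.
Qed.

Lemma facet_piece i j : i != j ->
  facet (notched_box_piece i `&` notched_box_piece j) (notched_box_piece i).
Proof.
move=> ij.
pose u : 'cV[R]_n := D i *: delta_mx i 0 - D j *: delta_mx j 0.
have uE (x : 'rV[R]_n) : (x *m u) 0 0 = D i * x 0 i - D j * x 0 j.
  rewrite mulmxBr -!scalemxAr -!colE !mxE; congr (_ - _).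
have IE : notched_box_piece i `&` notched_box_piece j =
    notched_box_piece i `&` [set x | (x *m u) 0 0 = 0].
  apply/seteqP; split => x /=; rewrite uE.
    move=> [[x02 xi xij] [_ _ xji]]; split; first by split.
    by apply/eqP; rewrite subr_eq0 eq_le xij xji.
  move=> [[x02 xi xij] /eqP]; rewrite subr_eq0 => /eqP xE; split; split => //.
    by rewrite -xE.
  by move=> l; rewrite -xE.
split.
  exists u, 0; split => // x [_ _ xmin]; rewrite uE subr_le0; exact: xmin.
have n_gt0 : (0 < n)%N by exact: leq_ltn_trans (leq0n i) (ltn_ord i).
exists n.-1; rewrite prednK //; split; last first.
  exact/affine_dim_full/affine_span_piece.
(* The span is the hyperplane orthogonal to [u], the row space of [kermx u]. Its rank is n - 1 since
   [u] is nonzero: its entry at i is [D i]. *)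
exists 0, (kermx u); split.
  rewrite mxrank_ker; suff -> : \rank u = 1%N by rewrite subn1.
  apply/eqP; rewrite eqn_leq rank_leq_col lt0n mxrank_eq0.
  apply/eqP => /matrixP/(_ i 0); rewrite !mxE !eqxx (negbTE ij) /=.
  by rewrite mulr0 subr0 mulr1; apply/eqP.
apply/seteqP; split => x /=; rewrite subr0.
  move=> xs; apply/sub_kermxP.
  have := @affine_span_orthogonal _ _ _ u 0 _ x xs.
  rewrite IE => /(_ (@subIsetr _ _ _)) /= xu.
  by apply/matrixP => a b; rewrite !ord1 xu mxE.
move=> /sub_kermxP xu; have := uE x; rewrite xu mxE => /esym/eqP.
rewrite subr_eq0 => /eqP xE.
apply: (@affine_span_coords _ i).
- by split; exact: notched_box_piece0.
- by split; exact: notched_box_piece_tip.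
- move=> l xl; split; apply: notched_box_piece_delta.
    by apply: contra_neq xl => ->.
  by apply: contra_neq xl => ->.
Qed.

Lemma rational_polytope_notched_box i0 : rational_polytope notched_box.
Proof.
split; first exact: (topological_ball_notched_box i0).
exists n, notched_box_piece; split.
- exact: notched_box_bigcup.
- exact: convex_rational_polytope_piece.
- by move=> i j; rewrite !affine_span_piece.
- move=> i j ij _; split; first exact: facet_piece.
  by rewrite setIC; apply: facet_piece; rewrite eq_sym.
Qed.

(** * Nonconvexity *)

(** The point [v k] has coordinate 1/d_k at k and 2 elsewhere. The midpoint of [v i] and [v j] lies
    in the removed corner: d_l x_l is 1/2 + d_l at i and j, and 2 d_l elsewhere, always above 1. *)
Lemma notched_box_not_convex i j : i != j -> ~ convex_set notched_box.
Proof.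
move=> ij Bconv.
pose v k : 'rV[R]_n := \row_l if l == k then (D l)^-1 else 2.
have Bv k : notched_box (v k).
  split => [l|]; last by exists k; rewrite mxE eqxx divff.
  rewrite mxE; case: ifP => _; last by rewrite ler0n lexx.
  by rewrite invD_ge0 (le_trans (invD_le1 l)) // ler1n.
have half01 : 0 <= (2^-1 : R) <= 1 by lra.
have := Bconv (v i) (v j) (Itv01 (proj1 (andP half01)) (proj2 (andP half01))).
rewrite !inE => /(_ (Bv i) (Bv j)) [_ [l]].
rewrite /conv /= !mxE /unstable.onem mulrDr ![D l * (_ * _)]mulrCA.
have D1 := D_ge1 l; have DV : D l * (D l)^-1 = 1 by rewrite divff.
have [li|_] := eqVneq l i; first by rewrite {4}li (negbTE ij) DV; lra.
by case: ifP => _; rewrite ?DV; lra.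
Qed.

End NotchedBox.

(** * Counting lattice points in dilates *)

Section LatticeCount.
Variables (R : realType) (n : nat) (d : 'I_n -> nat).
Hypothesis d_gt0 : forall l, (0 < d l)%N.

Let grid (k : nat) := {ffun 'I_n -> 'I_(2 * k).+1}.

Let off_notch (k : nat) : {set grid k} :=
  [set f : grid k | [exists l, d l * f l <= k]%N].

Let grid_point (k : nat) (f : grid k) : 'rV[int]_n := \row_l (f l : nat)%:Z.

Let grid_point_inj k : injective (@grid_point k).
Proof.
move=> f g /rowP fg; apply/ffunP => l; apply: val_inj.
by have := fg l; rewrite !mxE => -[].
Qed.

Let lattice_points_notched_box k : (0 < k)%N ->
  lattice_points (@notched_box R n d) k =
  [set` [fset grid_point f | f in off_notch k]%fset].
Proof.
move=> k0; have kR : (0 < k%:R :> R) by rewrite ltr0n.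
apply/seteqP; split => z /=.
  move=> [x [x02 [l0 xl0]] zx].
  have zE l : (z 0 l)%:~R = k%:R * x 0 l :> R.
    by have /rowP/(_ l) := zx; rewrite !mxE.
  have z_ge0 l : 0 <= z 0 l.
    by rewrite -(ler0z R) zE mulr_ge0 ?ler0n //; case/andP: (x02 l).
  have zN l : (absz (z 0 l))%:R = k%:R * x 0 l :> R.
    by rewrite -zE -[in RHS](gez0_abs (z_ge0 l)).
  have z_lt l : (absz (z ord0 l) < (2 * k).+1)%N.
    rewrite ltnS -(ler_nat R) zN natrM mulrC ler_pM2r //.
    by case/andP: (x02 l).
  apply/imfsetP; exists [ffun l => Ordinal (z_lt l)] => /=; last first.
    by apply/rowP => l; rewrite mxE ffunE /= gez0_abs.
  rewrite inE; apply/existsP; exists l0; rewrite ffunE /=.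
  rewrite -(ler_nat R) natrM zN mulrCA -[leRHS]mulr1.
  by rewrite ler_pM2l.
move=> /imfsetP[f /=]; rewrite inE => /existsP[l0 fl0] ->.
exists (k%:R^-1 *: \row_l (f l)%:R); last first.
  rewrite scalerA divff ?gt_eqF // scale1r.
  by apply/rowP => l; rewrite !mxE.
split => [l|]; last first.
  exists l0; rewrite !mxE mulrCA -natrM ler_pdivrMl // mulr1.
  by rewrite ler_nat.
rewrite !mxE mulr_ge0 ?invr_ge0 ?ler0n //= ler_pdivrMl // mulrC -natrM ler_nat.
by rewrite -ltnS.
Qed.

Let card_ord_gt N q : #|[pred z : 'I_N.+1 | (q < z)%N]| = (N - q)%N.
Proof.
rewrite -sum1_card -(big_geq_mkord q.+1 N.+1 xpredT (fun=> 1%N)).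
by rewrite sum_nat_const_nat muln1 subSS.
Qed.

(** The product counts the complement in the grid {0, ..., 2k}^n: the removed points are those with
    every coordinate above floor(k/d_l). The additive form avoids truncated subtraction of the two
    counts. *)
Lemma lattice_count_notched_box k : (0 < k)%N ->
  (lattice_count (@notched_box R n d) k + \prod_l (2 * k - k %/ d l) =
   (2 * k).+1 ^ n)%N.
Proof.
move=> k0; rewrite /lattice_count lattice_points_notched_box // set_fsetK.
rewrite (card_imfset _ _ (@grid_point_inj k)) /= -cardE.
have -> : (\prod_l (2 * k - k %/ d l) = #|~: off_notch k|)%N.
  rewrite -[RHS](@eq_card _ (mem (family
      (fun l => [pred z : 'I_(2 * k).+1 | (k %/ d l < z)%N])))).
    rewrite card_family foldrE big_image /=.
    by apply: eq_bigr => l _; rewrite card_ord_gt.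
  move=> f; rewrite !inE negb_exists; apply: eq_forallb => l /=.
  by rewrite -ltnNge inE ltn_divLR // mulnC.
by rewrite cardsC card_ffun !card_ord.
Qed.

End LatticeCount.

(** * Ehrhart coefficients and their periods *)

Section PeriodSequence.
Variables (R : realType) (m p : nat).
Hypothesis p_gt0 : (0 < p)%N.

Definition slab_denominator (l : 'I_m.+1) : nat :=
  if l == ord_max then p else 1.

Lemma slab_denominator_gt0 l : (0 < slab_denominator l)%N.
Proof. by rewrite /slab_denominator; case: ifP. Qed.

(** Here n = m + 1. The binomial term expands (2k+1)^n; substituting floor(k/p) = (k - k mod p)/p in
    -k^m (2k - floor(k/p)) gives the corrections in degrees m + 1 and m. *)
Definition notched_box_coef (i : 'I_m.+2) (k : int) : rat :=
  ('C(m.+1, i) * 2 ^ i)%N%:R +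
  (if i == m.+1 :> nat then p%:R^-1 - 2 else 0) -
  (if i == m :> nat then ((k %% p)%Z)%:~R / p%:R else 0).

Lemma prod_slab k :
  (\prod_l (2 * k - k %/ slab_denominator l) = (2 * k - k %/ p) * k ^ m)%N.
Proof.
rewrite big_ord_recr /= {2}/slab_denominator eqxx mulnC; congr muln.
rewrite -[in RHS](card_ord m) -prod_nat_const; apply: eq_bigr => l _.
rewrite /slab_denominator ifF; last by rewrite -val_eqE /= ltn_eqF.
by rewrite divn1 mul2n -addnn addnK.
Qed.

Lemma ehrhart_coefficients_notched_box :
  ehrhart_coefficients (@notched_box R m.+1 slab_denominator) notched_box_coef.
Proof.
split=> [i|k k0].
  by exists p => // k; rewrite /notched_box_coef modzDr.
have /(congr1 (fun N => N%:R : rat)) :=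
  lattice_count_notched_box R slab_denominator_gt0 k0.
rewrite natrD prod_slab => /(canRL (addrK _)) ->.
under eq_bigr do rewrite /notched_box_coef mulrBl mulrDl.
rewrite sumrB big_split /= -addrA; congr (_ + _).
  rewrite -addn1 natrX natrD addrC exprDn; apply: eq_bigr => i _.
  by rewrite expr1n mul1r !natrM natrX exprMn -mulrnAl mulr_natl.
have sum1 (j : 'I_m.+2) (a : rat) :
    \sum_(i < m.+2) (if i == j :> nat then a else 0) * k%:R ^+ i
    = a * k%:R ^+ j.
  rewrite (bigD1 j) //= eqxx big1 ?addr0 // => i.
  by rewrite -val_eqE /= => /negbTE ->; exact: mul0r.
rewrite (sum1 ord_max) (sum1 (widen_ord (leqnSn _) ord_max)) /=.
have kp : (k %/ p <= 2 * k)%N by rewrite (leq_trans (leq_div _ _)) // leq_pmull.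
rewrite natrM natrB // natrX modz_nat.
have p0 : (p%:R : rat) != 0 by rewrite pnatr_eq0 -lt0n.
have /(congr1 (fun N => N%:R : rat)) := divn_eq k p; rewrite natrD natrM => kE.
(* Eliminating k mod p in favour of floor(k/p) leaves an identity of fractions. *)
have -> : ((k %% p)%N%:~R : rat) = k%:R - (k %/ p)%:R * p%:R.
  by rewrite [in RHS]kE addrC addKr.
by rewrite natrM exprS; field.
Qed.

Lemma minimum_period_notched_box_coef i :
  minimum_period (notched_box_coef i) (if i == m :> nat then p else 1%N).
Proof.
rewrite /minimum_period /notched_box_coef; case: (eqVneq (i : nat) m) => im.
  split => // [k|q q0 qper]; first by rewrite modzDr.
  (* Equal values at q and at 0 force q mod p = 0, hence p divides q. *)
  have /eqP := qper 0; rewrite add0r mod0z mul0r subr0 -subr_eq0 addrAC subrr.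
  rewrite add0r oppr_eq0 mulf_eq0 invr_eq0 pnatr_eq0.
  rewrite -[p == 0%N]negbK -lt0n p_gt0.
  rewrite orbF intr_eq0 modz_nat => /eqP[qp].
  by apply: dvdn_leq => //; apply/eqP.
by split.
Qed.

Lemma period_sequence_notched_box :
  period_sequence (@notched_box R m.+1 slab_denominator)
    (fun i => if i == m :> nat then p else 1%N).
Proof.
exists notched_box_coef; split; first exact: ehrhart_coefficients_notched_box.
exact: minimum_period_notched_box_coef.
Qed.

End PeriodSequence.

Theorem theorem1p4 (R : realType) (p n : nat) (hp : (0 < p)%N)
    (hn : (3 <= n <= 11)%N \/ n = 13%N) :
  exists B : set 'rV[R]_n,
    [/\ rational_polytope B,
        affine_dim B n,
        ~ convex_set B &
        period_sequence B (fun i => if i == n.-1 :> nat then p else 1%N)].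
Proof.
(* In this form [ord0] and [ord_max] are distinct coordinates, as nonconvexity requires, and [n.-1]
   reduces to [m.+1], the degree whose coefficient has period p. *)
have [m ->] : exists m, n = m.+2.
  by exists n.-2; case: hn => [|->] //; case: n => [|[]].
have d_gt0 := @slab_denominator_gt0 m.+1 p hp.
exists (@notched_box R m.+2 (@slab_denominator m.+1 p)); split.
- exact: (rational_polytope_notched_box R d_gt0 ord0).
- exact: (affine_dim_notched_box R d_gt0 ord0).
- exact: (@notched_box_not_convex R _ _ d_gt0 ord0 ord_max).
- exact: period_sequence_notched_box.
Qed.
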